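(* Let $(\mathcal M_1,d_1)$, $(\mathcal M_2,d_2)$ be metric spaces, and let $0<s_1,s_2\le 1$. If $(\mathcal M_1,d_1^{s_1})$ Lipschitz embeds into $(\mathcal M_2,d_2^{s_2})$, then $$\frac{\text{E-type}(\mathcal M_1)}{s_1}\ge\frac{\text{E-type}(\mathcal M_2)}{s_2}\qquad\text{and}\qquad \frac{\dim_{\mathcal H}(\mathcal M_1)}{s_1}\le\frac{\dim_{\mathcal H}(\mathcal M_2)}{s_2}.$$
   Context: $\dim_{\mathcal H}$ denotes Hausdorff dimension. For a metric $d$, $d^s$ denotes $(x,y)\mapsto d(x,y)^s$. A metric space $(\mathcal M_1,d_1)$ Lipschitz embeds into $(\mathcal M_2,d_2)$ if there are a one-to-one map $f:\mathcal M_1\to\mathcal M_2$ and constants $A,B>0$ with $A^{-1}d_1(x,y)\le d_2(f(x),f(y))\le B\,d_1(x,y)$ for all $x,y\in\mathcal M_1$. An $n$-dimensional cube in a metric space $\mathcal M$ is a family $C=(x_u)_{u\in\{-1,1\}^n}$ of $2^n$ not necessarily distinct points of $\mathcal M$. A diagonal of $C$ is an unordered pair $\{x_u,x_{-u}\}$; an edge is an unordered pair $\{x_u,x_v\}$ with $u,v$ differing in exactly one coordinate. $D(C)$ and $E(C)$ are the collections of the $2^{n-1}$ diagonals and the $n2^{n-1}$ edges (counted by index pairs). $(\mathcal M,d)$ has Enflo-type $p\ge1$ if there is $K>0$ such that for every $n\in\mathbb N$ and every $n$-dimensional cube $C$ in $\mathcal M$, $\sum_{\{a,b\}\in D(C)}d(a,b)^p\le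 K^p\sum_{\{a,b\}\in E(C)}d(a,b)^p$. Put $\text{E-type}(\mathcal M)=\sup\{p:\mathcal M\text{ has Enflo-type }p\}\in[1,\infty]$. The values $\infty$ are treated in the usual way ($\infty/s=\infty$). *)

(* Defs.v *)
From HB Require Import structures.
From mathcomp Require Import all_boot all_order all_algebra.
From mathcomp Require Import all_classical all_reals all_analysis.
Set Implicit Arguments.
Unset Strict Implicit.
Unset Printing Implicit Defensive.
Import Order.TTheory GRing.Theory Num.Theory.
Import numFieldNormedType.Exports.
Local Open Scope classical_set_scope.
Local Open Scope ring_scope.

(* Distances are passed as functions so that the snowflake d^s can be used
   directly on the same carrier. *)
Definition lipschitz_embeds (R : realType) (T1 T2 : Type)
    (d1 : T1 -> T1 -> R) (d2 : T2 -> T2 -> R) : Prop :=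
  exists (f : T1 -> T2) (A B : R),
    [/\ injective f, 0 < A, 0 < B &
        forall x y, A^-1 * d1 x y <= d2 (f x) (f y) <= B * d1 x y].

Definition snowflake (R : realType) (M : metricType R) (s : R) (x y : M) : R :=
  mdist x y `^ s.

(* {-1,1}^n, with true standing for 1 and false for -1. *)
Definition signs (n : nat) := {ffun 'I_n -> bool}.

Definition antipodal n (u v : signs n) : bool := [forall i, v i == ~~ u i].

Definition adjacent n (u v : signs n) : bool := #|[pred i | u i != v i]| == 1%N.

(* An unordered pair of distinct indices {u,v} is represented by its unique
   ordering (u,v) with u before v in the enumeration of [signs n]. *)
Definition diagonals n : {set signs n * signs n} :=
  [set e | (enum_rank e.1 < enum_rank e.2)%N && antipodal e.1 e.2].

Definition edges n : {set signs n * signs n} :=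
  [set e | (enum_rank e.1 < enum_rank e.2)%N && adjacent e.1 e.2].

(* The condition 1 <= p is imposed in [E_type]. For n = 0 there is no pair of
   distinct indices, so the inequality reads 0 <= 0. *)
Definition has_enflo_type (R : realType) (M : metricType R) (p : R) : Prop :=
  exists2 K : R, 0 < K & forall (n : nat) (x : signs n -> M),
    \sum_(e in diagonals n) mdist (x e.1) (x e.2) `^ p <=
    K `^ p * \sum_(e in edges n) mdist (x e.1) (x e.2) `^ p.

Definition E_type (R : realType) (M : metricType R) : \bar R :=
  ereal_sup [set p%:E | p in [set p : R | 1 <= p /\ has_enflo_type M p]].

Section hausdorff.
Context (R : realType) (M : metricType R).
Implicit Types (A : set M) (s delta : R).
Local Open Scope ereal_scope.

(* The maximum with 0 only matters for set0, whose supremum is -oo. *)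
Definition diameter A : \bar R :=
  maxe 0 (ereal_sup [set (mdist z.1 z.2)%:E | z in A `*` A]).

(* diam(A)^s with the usual conventions: set0 contributes 0 even for s = 0,
   whereas 0 `^ 0 = 1 for a singleton. *)
Definition diameter_pow s A : \bar R :=
  if A == set0 then 0 else diameter A `^ s.

Definition hausdorff_premeasure s delta A : \bar R :=
  ereal_inf [set \sum_(0 <= k <oo) diameter_pow s (U k) | U in
    [set U : (set M)^nat | A `<=` \bigcup_k U k /\
                           forall k, diameter (U k) <= delta%:E]].

(* The supremum over delta > 0 is the limit as delta tends to 0. *)
Definition hausdorff_measure s A : \bar R :=
  ereal_sup [set hausdorff_premeasure s delta A | delta in
    [set delta | (0 < delta)%R]].

Definition hausdorff_dim : \bar R :=
  ereal_inf [set s%:E | s in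
    [set s : R | (0 <= s)%R /\ hausdorff_measure s [set: M] = 0]].

End hausdorff.
Arguments hausdorff_dim {R} M.

(* Main.v *)
Require Import Defs.
From mathcomp Require Import all_boot all_order all_algebra.
From mathcomp Require Import all_classical all_reals all_analysis.
Import Order.TTheory GRing.Theory Num.Theory.
Import numFieldNormedType.Exports.
Local Open Scope classical_set_scope.
Local Open Scope ring_scope.

(** Raise the two inequalities that relate [d1^s1] and [d2^s2] to a power
[q]: they become a comparison, up to constants, of [d1^(s1 * q)] with
[d2^(s2 * q)] ([powR_comparison]).  Both halves of the proposition transport
a property of exponent [s2 * q] on the second space to the exponent [s1 * q]
on the first one, which is exactly what the division by [s1] and [s2]
expresses.

For Enflo type, the image under [f] of a cube of [M1] is a cube of [M2].
Its diagonals bound those of the original cube from above and its edges are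
bounded by those of the original cube, so that the inequality of exponent
[s2 * q] in [M2] gives the one of exponent [s1 * q] in [M1]
([has_enflo_type_snowflake]).  An exponent only counts in [E_type] when it is
at least [1].  When [s1 * q < 1], the bound comes instead from the fact that
every metric space has Enflo type [1] ([has_enflo_type1]): by the triangle
inequality along a path that flips the coordinates one after the other, each
diagonal is at most the sum of [n] edges, and these paths, taken from all the
vertices, run over each edge equally often.

For the Hausdorff dimension, the preimages under [f] of a cover of [M2] form a
cover of [M1].  If [U] has diameter [r], its preimage has diameter at most
[(A * r `^ s2) `^ s1^-1], which is as small as desired with [r], and whose
power [s1 * q] is [A `^ q * r `^ (s2 * q)].  Hence if [M2] has measure zero in
dimension [s2 * q], then [M1] has measure zero in dimension [s1 * q]
([hausdorff_measure0_snowflake]). *)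

Lemma powR_comparison {R : realType} {c a b s1 s2 q : R} :
  0 <= c -> 0 <= q -> a `^ s1 <= c * b `^ s2 ->
  a `^ (s1 * q) <= c `^ q * b `^ (s2 * q).
Proof.
move=> c0 q0 ab; rewrite 2!powRrM -powRM ?powR_ge0//.
by apply: ge0_ler_powR; rewrite ?nnegrE ?mulr_ge0 ?powR_ge0.
Qed.

(** * Every metric space has Enflo type 1 *)

(** Each unordered pair of related elements is met twice, once in each order.
Sums over all the ordered pairs are easier to reindex, since they carry no
trace of the enumeration that selects one order of each pair. *)
Lemma sum_sym_rel {R : nmodType} {T : finType} {r : rel T} (F : T -> T -> R) :
  symmetric r -> irreflexive r -> (forall x y, F x y = F y x) ->
  \sum_x \sum_(y | r x y) F x y =
  (\sum_(e in [set e : T * T |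
     (enum_rank e.1 < enum_rank e.2)%N && r e.1 e.2]%SET) F e.1 e.2) *+ 2.
Proof.
move=> rsym rirr Fsym; rewrite pair_big_dep /=.
rewrite (bigID (fun e : T * T => (enum_rank e.1 < enum_rank e.2)%N)) /= mulr2n.
congr (_ + _); first by apply: eq_bigl => e; rewrite inE andbC.
have swapK : involutive (fun e : T * T => (e.2, e.1)) by case.
rewrite (reindex_inj (inv_inj swapK)) /=.
apply: eq_big => [[x y]|[x y] _] /=; last exact: Fsym.
rewrite inE /= rsym andbC -leqNgt leq_eqVlt.
case: (eqVneq x y) => [->|xy]; first by rewrite rirr !andbF.
by rewrite (inj_eq val_inj) (inj_eq enum_rank_inj) (negbTE xy).
Qed.

(** All the vertices involved are obtained in this way: the antipode of [u] for
[P = predT], its neighbours for [P = pred1 i], and the points of the path that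
joins [u] to its antipode when [P] is an initial segment. *)
Definition toggle {n} (P : pred 'I_n) (u : signs n) : signs n :=
  [ffun j => u j (+) P j].

Lemma toggleK {n} (P : pred 'I_n) : involutive (toggle P).
Proof. by move=> u; apply/ffunP => j; rewrite !ffunE addbK. Qed.

Lemma antipodal_toggle {n} (u v : signs n) :
  antipodal u v = (v == toggle predT u).
Proof.
apply/forallP/eqP => [uv|-> j]; last by rewrite ffunE addbT.
by apply/ffunP => j; rewrite ffunE addbT; apply/eqP.
Qed.

Lemma adjacent_toggle {n} (u : signs n) (i : 'I_n) :
  Defs.adjacent u (toggle (pred1 i) u).
Proof.
rewrite /Defs.adjacent -(card1 i); apply/eqP/eq_card => j; rewrite !inE ffunE /=.
by case: (u j); case: (j == i).
Qed.

Lemma toggle1_inj {n} (u : signs n) : injective (fun i => toggle (pred1 i) u).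
Proof.
move=> i j /ffunP/(_ i); rewrite !ffunE /= eqxx.
by case: eqP => // _; case: (u i).
Qed.

Lemma antipodal_sym {n} : symmetric (@antipodal n).
Proof.
by move=> u v; apply: eq_forallb => i; case: (u i); case: (v i).
Qed.

(** The only vertex of the cube of dimension 0 is its own antipode, hence the
successor. *)
Lemma antipodal_irr {n} : irreflexive (@antipodal n.+1).
Proof. by move=> u; apply/negbTE/forallPn; exists ord0; case: (u ord0). Qed.

Lemma adjacent_sym {n} : symmetric (@Defs.adjacent n).
Proof.
by move=> u v; congr (_ == _); apply: eq_card => i; rewrite !inE eq_sym.
Qed.

Lemma adjacent_irr {n} : irreflexive (@Defs.adjacent n).
Proof.
move=> u; rewrite /Defs.adjacent eq_card0// => i.
by rewrite !inE eqxx.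
Qed.

Lemma le_sum_adjacent {R : realType} {n} (F : signs n -> R) (u : signs n) :
  (forall v, 0 <= F v) ->
  \sum_(i < n) F (toggle (pred1 i) u) <= \sum_(v | Defs.adjacent u v) F v.
Proof.
move=> F0.
rewrite -(big_imset F (h := fun i => toggle (pred1 i) u) (A := 'I_n)) /=; last first.
  by move=> i j _ _; apply: toggle1_inj.
rewrite big_mkcond [leRHS]big_mkcond; apply: ler_sum => v _.
case: ifPn => [/imsetP[i _ ->]|_]; first by rewrite adjacent_toggle.
by case: ifP.
Qed.

(** Triangle inequality along the path that starts at [u] and flips the first
[m] coordinates in order. *)
Lemma mdist_toggle_prefix {R : realType} {M : metricType R} {n}
    (x : signs n -> M) (u : signs n) {m : nat} : (m <= n)%N ->
  mdist (x u) (x (toggle (fun j => (j < m)%N) u)) <=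
  \sum_(i < n | (i < m)%N)
     mdist (x (toggle (fun j => (j < i)%N) u))
           (x (toggle (pred1 i) (toggle (fun j => (j < i)%N) u))).
Proof.
elim: m => [_|m IH mn].
  have -> : toggle (fun j => (j < 0)%N) u = u.
    by apply/ffunP => j; rewrite ffunE addbF.
  by rewrite mdistxx big_pred0.
rewrite (bigD1 (Ordinal mn))//= addrC.
(* The new step of the path is the edge in direction [m]. *)
apply: (le_trans (metric_triangle _ (x (toggle (fun j => (j < m)%N) u)) _)).
apply: lerD.
  apply: (le_trans (IH (ltnW mn))); rewrite le_eqVlt; apply/orP; left; apply/eqP.
  by apply: eq_bigl => i; rewrite -val_eqE /= ltnS ltn_neqAle andbC.
rewrite le_eqVlt; apply/orP; left; apply/eqP; congr (mdist _ (x _)).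
apply/ffunP => j; rewrite !ffunE /= -val_eqE /= -addbA; congr (_ (+) _).
by rewrite ltnS leq_eqVlt; case: ltngtP.
Qed.

Lemma mdist_antipode {R : realType} {M : metricType R} {n}
    (x : signs n -> M) (u : signs n) :
  mdist (x u) (x (toggle predT u)) <=
  \sum_(i < n) mdist (x (toggle (fun j => (j < i)%N) u))
           (x (toggle (pred1 i) (toggle (fun j => (j < i)%N) u))).
Proof.
have := mdist_toggle_prefix x u (leqnn n).
have -> : toggle (fun j : 'I_n => (j < n)%N) u = toggle predT u.
  by apply/ffunP => j; rewrite !ffunE ltn_ord.
by rewrite (eq_bigl predT)// => i; rewrite ltn_ord.
Qed.

(** The [i]-th step of the path issued from [u] is the edge in direction [i]
at the vertex obtained from [u] by flipping the coordinates before [i].  For a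
fixed [i] this vertex is an involutive function of [u], so that when [u] varies
the [i]-th steps run exactly once over all the vertices. *)
Lemma sum_diagonals_le_sum_edges {R : realType} {M : metricType R} {n}
    (x : signs n -> M) :
  \sum_(e in diagonals n) mdist (x e.1) (x e.2) <=
  \sum_(e in edges n) mdist (x e.1) (x e.2).
Proof.
case: n x => [|n] x.
  (* A single vertex has no diagonal. *)
  rewrite big_pred0; first by apply: sumr_ge0 => e _; exact: mdist_ge0.
  move=> [u v]; rewrite inE /=.
  have -> : u = v by apply/ffunP => -[].
  by rewrite ltnn.
rewrite -(ler_pMn2r (isT : (0 < 2)%N)).
rewrite -(sum_sym_rel (fun u v => mdist (x u) (x v)) antipodal_sym); last 2 first.
- exact: antipodal_irr.
- by move=> u v; exact: metric_sym.
rewrite -(sum_sym_rel (fun u v => mdist (x u) (x v)) adjacent_sym); last 2 first.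
- exact: adjacent_irr.
- by move=> u v; exact: metric_sym.
apply: (@le_trans _ _ (\sum_u \sum_(i < n.+1)
   mdist (x u) (x (toggle (pred1 i) u)))); last first.
  apply: ler_sum => u _.
  apply: (le_sum_adjacent (fun v => mdist (x u) (x v))) => v.
  exact: mdist_ge0.
rewrite exchange_big /=.
(* The base point of the [i]-th edges is replaced by the [i]-th vertex of the
   path issued from [u]. *)
under [leRHS]eq_bigr => i _ do
  rewrite (reindex_inj (inv_inj (toggleK (fun j : 'I_n.+1 => (j < i)%N)))).
rewrite exchange_big /=; apply: ler_sum => u _.
rewrite (big_pred1 (toggle predT u)); first exact: mdist_antipode.
by move=> v; rewrite /= antipodal_toggle.
Qed.

Lemma has_enflo_type1 (R : realType) (M : metricType R) : has_enflo_type M 1.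
Proof.
exists 1 => // n x; rewrite powR1 mul1r.
under eq_bigr do rewrite powRr1 ?mdist_ge0//.
under [leRHS]eq_bigr do rewrite powRr1 ?mdist_ge0//.
exact: sum_diagonals_le_sum_edges.
Qed.

(** * Transport of Enflo type *)

Lemma has_enflo_type_snowflake {R : realType} {M1 M2 : metricType R}
    {s1 s2 A B q : R} {f : M1 -> M2} :
  0 < s1 -> 0 < A -> 0 < B -> 0 < q ->
  (forall x y, mdist x y `^ s1 <= A * mdist (f x) (f y) `^ s2) ->
  (forall x y, mdist (f x) (f y) `^ s2 <= B * mdist x y `^ s1) ->
  has_enflo_type M2 (s2 * q) -> has_enflo_type M1 (s1 * q).
Proof.
move=> s1_gt0 A_gt0 B_gt0 q0 fA fB [K K0 enflo].
(* The new constant appears in the conclusion through its power [s1 * q], which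
   is [c]: the constant of [M2] times the two distortions of [f]. *)
pose c := A `^ q * (K `^ (s2 * q) * B `^ q).
have c0 : 0 < c by rewrite !mulr_gt0 ?powR_gt0.
exists (c `^ (s1 * q)^-1); first exact: powR_gt0.
move=> n x; rewrite -powRrM mulVf ?gt_eqF ?mulr_gt0// powRr1 ?(ltW c0)//.
apply: (@le_trans _ _ (A `^ q *
    \sum_(e in diagonals n) mdist (f (x e.1)) (f (x e.2)) `^ (s2 * q))).
  rewrite mulr_sumr; apply: ler_sum => e _.
  exact: powR_comparison (ltW A_gt0) (ltW q0) (fA _ _).
rewrite /c -mulrA ler_pM2l ?powR_gt0//.
apply: (le_trans (enflo n (f \o x))).
rewrite -mulrA ler_pM2l ?powR_gt0// mulr_sumr; apply: ler_sum => e _.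
exact: powR_comparison (ltW B_gt0) (ltW q0) (fB _ _).
Qed.

(** * Transport of Hausdorff dimension *)

Section hausdorff_facts.
Local Open Scope ereal_scope.
Context {R : realType} {M : metricType R}.

Lemma diameter_ge0 (A : set M) : 0 <= diameter A.
Proof. by rewrite /diameter le_max lexx. Qed.

Lemma diameter_leP {A : set M} {r : R} : (0 <= r)%R ->
  diameter A <= r%:E <-> (forall x y, A x -> A y -> (mdist x y <= r)%R).
Proof.
move=> r0; split=> [|Ar]; rewrite /diameter ge_max lee_fin r0 /=.
  move=> Ar x y Ax Ay; rewrite -lee_fin; apply: le_trans Ar.
  by apply: ereal_sup_ubound; exists (x, y).
apply: ge_ereal_sup => _ [[x y] [/= Ax Ay] <-]; rewrite lee_fin; exact: Ar.
Qed.

Lemma diameter_pow_ge0 (t : R) (A : set M) : 0 <= diameter_pow t A.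
Proof. by rewrite /diameter_pow; case: ifP => // _; exact: poweR_ge0. Qed.

Lemma hausdorff_premeasure_ge0 (t delta : R) (A : set M) :
  0 <= hausdorff_premeasure t delta A.
Proof.
apply: le_ereal_inf_tmp => _ [U _ <-].
by apply: nneseries_ge0 => k _ _; exact: diameter_pow_ge0.
Qed.

Lemma hausdorff_measure_eq0 {t : R} {A : set M} :
  hausdorff_measure t A = 0 <->
  forall delta : R, (0 < delta)%R -> hausdorff_premeasure t delta A <= 0.
Proof.
split=> [<- delta d0|H]; first by apply: ereal_sup_ubound; exists delta.
apply/eqP; rewrite eq_le; apply/andP; split.
  by apply: ge_ereal_sup => _ [delta d0 <-]; exact: H.
apply: (le_trans (hausdorff_premeasure_ge0 t 1 A)).
by apply: ereal_sup_ubound; exists 1%R => //=.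
Qed.

End hausdorff_facts.

Section hausdorff_embedding.
Context {R : realType} {M1 M2 : metricType R} {s1 s2 A : R} {f : M1 -> M2}.
Hypotheses (s1_gt0 : 0 < s1) (s2_gt0 : 0 < s2) (A_gt0 : 0 < A).
Hypothesis fA : forall x y, mdist x y `^ s1 <= A * mdist (f x) (f y) `^ s2.

Lemma diameter_preimage {U : set M2} {r : R} : 0 <= r ->
  (diameter U <= r%:E)%E ->
  (diameter (f @^-1` U) <= ((A * r `^ s2) `^ s1^-1)%:E)%E.
Proof.
move=> r0 /(diameter_leP r0) Ur.
apply/(diameter_leP (powR_ge0 _ _)) => x y Ux Uy.
have -> : mdist x y = (mdist x y `^ s1) `^ s1^-1.
  by rewrite -powRrM mulfV ?gt_eqF// powRr1// mdist_ge0.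
apply: ge0_ler_powR; rewrite ?nnegrE ?powR_ge0 ?invr_ge0 ?(ltW s1_gt0)//.
  by rewrite mulr_ge0 ?powR_ge0 ?ltW.
apply: (le_trans (fA x y)); rewrite ler_pM2l//.
by apply: ge0_ler_powR; rewrite ?nnegrE ?mdist_ge0 ?(ltW s2_gt0)//; exact: Ur.
Qed.

(** The value 0 at [set0] is a convention, which matters for [q = 0].  It does
not spoil the inequality: a nonempty preimage comes from a nonempty set. *)
Lemma diameter_pow_preimage {U : set M2} {q delta : R} : 0 <= q ->
  (diameter U <= delta%:E)%E ->
  (diameter_pow (s1 * q) (f @^-1` U) <=
   (A `^ q)%:E * diameter_pow (s2 * q) U)%E.
Proof.
move=> q0; rewrite /diameter_pow; case: ifPn => [_ _|V0].
  by rewrite mule_ge0 ?lee_fin ?powR_ge0//; exact: diameter_pow_ge0.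
have /negbTE -> : U != set0.
  by apply: contra_neq V0 => ->; rewrite preimage_set0.
have := diameter_ge0 U; case E : (diameter U) => [r| |]//; rewrite lee_fin => r0 _.
have := diameter_preimage r0; rewrite -E => /(_ _ (lexx _)).
have := diameter_ge0 (f @^-1` U).
case: (diameter (f @^-1` U)) => [v| |]//; rewrite !lee_fin => v0 vr.
rewrite E !poweR_EFin -EFinM lee_fin; apply: (powR_comparison (ltW A_gt0) q0).
apply: (@le_trans _ _ (((A * r `^ s2) `^ s1^-1) `^ s1)).
  by apply: ge0_ler_powR; rewrite ?nnegrE ?powR_ge0 ?(ltW s1_gt0).
by rewrite -powRrM mulVf ?gt_eqF// powRr1// mulr_ge0 ?powR_ge0 ?ltW.
Qed.

Lemma hausdorff_measure0_snowflake {q : R} : 0 <= q ->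
  (hausdorff_measure (s2 * q) [set: M2] = 0 ->
   hausdorff_measure (s1 * q) [set: M1] = 0)%E.
Proof.
move=> q0 /hausdorff_measure_eq0 H; apply/hausdorff_measure_eq0 => delta d0.
(* The bound of [diameter_preimage] takes the value [delta] at [delta']. *)
pose delta' := (delta `^ s1 / A) `^ s2^-1.
have d'0 : 0 < delta' by rewrite powR_gt0// divr_gt0 ?powR_gt0.
have d'E : (A * delta' `^ s2) `^ s1^-1 = delta.
  rewrite -powRrM mulVf ?gt_eqF// powRr1 ?divr_ge0 ?powR_ge0 ?ltW//.
  by rewrite mulrC divfK ?gt_eqF// -powRrM mulfV ?gt_eqF// powRr1 ?ltW.
have c0 : 0 < A `^ q by exact: powR_gt0.
rewrite -(mule0 (A `^ q)%:E) -lee_pdivrMl//.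
apply: le_trans (H _ d'0).
apply: le_ereal_inf_tmp => _ [U [covU Ud'] <-].
rewrite lee_pdivrMl// -nneseriesZl; last by move=> k _; exact: diameter_pow_ge0.
apply: (@le_trans _ _ (\sum_(0 <= k <oo)
  diameter_pow (s1 * q) (f @^-1` U k))%E).
  apply: ereal_inf_lbound; exists (fun k => f @^-1` U k) => //; split.
    by move=> x _; have [k _ Uk] := covU (f x) I; exists k.
  by move=> k; rewrite -d'E; apply: diameter_preimage => //; exact: ltW.
apply: lee_nneseries => [k _ _|k _]; first exact: diameter_pow_ge0.
exact: (diameter_pow_preimage q0 (Ud' k)).
Qed.

End hausdorff_embedding.

Theorem proposition2p3 (R : realType) (M1 M2 : metricType R) (s1 s2 : R)
  (hs1 : 0 < s1 <= 1) (hs2 : 0 < s2 <= 1)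
  (hemb : lipschitz_embeds (@snowflake R M1 s1) (@snowflake R M2 s2)) :
  (E_type M2 / s2%:E <= E_type M1 / s1%:E)%E /\
  (hausdorff_dim M1 / s1%:E <= hausdorff_dim M2 / s2%:E)%E.
Proof.
case/andP: hs1 => s1_gt0 _; case/andP: hs2 => s2_gt0 _.
case: hemb => f [A [B [_ A0 B0 fAB]]].
have fA x y : mdist x y `^ s1 <= A * mdist (f x) (f y) `^ s2.
  by have /andP[+ _] := fAB x y; rewrite ler_pdivrMl.
have fB x y : mdist (f x) (f y) `^ s2 <= B * mdist x y `^ s1.
  by have /andP[_] := fAB x y.
rewrite !inver !gt_eqF//; split.
- rewrite lee_pdivrMr//; apply: ge_ereal_sup => _ [p [p1 enflo] <-].
  rewrite -lee_pdivrMr// lee_pdivlMr// -!EFinM.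
  have q0 : 0 < p / s2 by rewrite divr_gt0// (lt_le_trans _ p1).
  (* An exponent below 1 does not enter [E_type M1]: it is then compared with
     the exponent 1. *)
  have [q1|q1] := leP 1 (s1 * (p / s2)); apply: le_ereal_sup_tmp.
    exists (s1 * (p / s2))%:E; last by rewrite lee_fin mulrC.
    exists (s1 * (p / s2)) => //; split=> //.
    apply: has_enflo_type_snowflake fA fB _ => //.
    by rewrite mulrC divfK ?gt_eqF.
  exists 1%:E; last by rewrite lee_fin mulrC ltW.
  by exists 1 => //; split => //; exact: has_enflo_type1.
- rewrite lee_pdivlMr//; apply: le_ereal_inf_tmp => _ [t [t0 Ht] <-].
  rewrite -lee_pdivlMr// lee_pdivrMr// -!EFinM.
  apply: ereal_inf_lbound; exists (s1 * (t / s2)); last by rewrite mulrC.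
  split; first by rewrite mulr_ge0 ?divr_ge0 ?(ltW s1_gt0) ?(ltW s2_gt0).
  apply: (hausdorff_measure0_snowflake s1_gt0 s2_gt0 A0 fA); rewrite ?divr_ge0 ?(ltW s2_gt0)//.
  by rewrite mulrC divfK ?gt_eqF.
Qed.
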